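(* Let $\lambda^0\in P$. Assume that $(x^*,y^* )$ is a parameter stable optimal solution to $(P_{\lambda^0})$, and let $\mathcal X\subset\mathbb R^n\times\mathbb Z^m$ be a finite set containing all the linearization points used to solve $(P_{\lambda^0})$ by the outer approximation (OA) algorithm. Assume furthermore that $(x^*,y^* )$ is an integer unique optimal solution to $\mathrm{MILP}(\mathcal X,\lambda^0)$ and that $g^\lambda$ is of the form $g^\lambda(x,y)=g(x,y)-F\lambda$ for all $\lambda\in P$, where $g:\mathbb R^{n+m}\to\mathbb R^p$ and $F\in\mathbb R^{p\times k}$ is a matrix with non-negative entries. Then there exists $\delta>0$ such that for any $\lambda^1\in H(\lambda^0,\delta)\cap P$, the OA algorithm applied to $(P_{\lambda^1})$ and warm-started with the linearization points $\mathcal X$ (i.e. with initial set of linearization points $\mathcal X$ and initial integer assignment $y^*$) finds an optimal solution to $(P_{\lambda^1})$ and terminates after a single iteration.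
   Context: Setting. $[p]:=\{1,\dots,p\}$; vector inequalities are componentwise; $\|\cdot\|$ is the Euclidean norm; $B(u,\delta):=\{v\mid\|u-v\|<\delta\}$; and $H(u,\delta):=\{v\mid v\in B(u,\delta),\ v\le u\}$. Let $P\subset\mathbb R^k$ be nonempty and connected. For $\lambda\in P$, the problem $(P_\lambda)$ is: minimize $c^\top x+d^\top y$ subject to $g^\lambda(x,y)\le 0$, $h(x,y)\le 0$, $Ax+By\le b$, $x\in\mathbb R^n$, $y\in\mathbb Z^m$, where $c\in\mathbb R^n$, $d\in\mathbb R^m$, $g^\lambda:\mathbb R^{n+m}\to\mathbb R^p$, $h:\mathbb R^{n+m}\to\mathbb R^q$, $A\in\mathbb R^{r\times n}$, $B\in\mathbb R^{r\times m}$, $b\in\mathbb R^r$. $\mathcal F_\lambda\subset\mathbb R^n\times\mathbb Z^m$ denotes its feasible set. Standing assumptions. For every $\lambda\in P$, each component of $g^\lambda$ and $h$ is convex and continuously differentiable on $\mathbb R^{n+m}$. The set $\mathcal F_L:=\{(x,y)\in\mathbb R^{n+m}\mid Ax+By\le b\}$ is nonempty and bounded. For all $(x,y)\in\mathcal F_L$, the map $\lambda\mapsto g^\lambda(x,y)$ is continuous on $P$. For every $\lambda\in P$ and every $\hat y\in\mathbb Z^m$ such that $\mathrm{NLP}(\hat y,\lambda)$ below is feasible, the linear independence constraint qualification (LICQ) holds at all its optimal solutions, i.e. the gradients with respect to $x$ of all active constraints (among the components of $g^\lambda(\cdot,\hat y)\le0$, $h(\cdot,\hat y)\le0$ and $A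 x+B\hat y\le b$) are linearly independent. Subproblems. For $\hat y\in\mathbb Z^m$, $\mathrm{NLP}(\hat y,\lambda)$ is: minimize $c^\top x+d^\top\hat y$ over $x\in\mathbb R^n$ subject to $(x,\hat y)\in\mathcal F_\lambda$. $\mathrm{NLP\text{-}Feas}(\hat y,\lambda)$ is: minimize $t$ over $(t,x)\in\mathbb R\times\mathbb R^n$ subject to $g^\lambda_i(x,\hat y)\le t$ for all $i\in[p]$, $h_i(x,\hat y)\le t$ for all $i\in[q]$, $Ax+B\hat y\le b$. For a differentiable $f:\mathbb R^{n+m}\to\mathbb R$, its linearization at $(\bar x,\bar y)$ is $\tilde f^{(\bar x,\bar y)}(x,y):=f(\bar x,\bar y)+\nabla f(\bar x,\bar y)^\top\begin{pmatrix}x-\bar x\\ y-\bar y\end{pmatrix}$. For a finite set $\mathcal X\subset\mathbb R^n\times\mathbb Z^m$ (the linearization points), $\Omega(\mathcal X,\lambda)$ is the set of all $(x,y)\in\mathbb R^n\times\mathbb Z^m$ with $Ax+By\le b$ such that, for every $(\bar x,\bar y)\in\mathcal X$, the linearizations at $(\bar x,\bar y)$ of all components $g^\lambda_j$ ($j\in[p]$) and $h_j$ ($j\in[q]$) are $\le 0$ at $(x,y)$. $\mathrm{MILP}(\mathcal X,\lambda)$ is: minimize $c^\top x+d^\top y$ subject to $(x,y)\in\Omega(\mathcal X,\lambda)$. OA algorithm for $(P_\lambda)$. Input: an initial integer assignment $y^{(0)}\in\mathbb Z^m$, an initial finite set of linearization points $\mathcal X^{(0)}$ (possibly empty), and a tolerance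 $\varepsilon_{\mathrm{tol}}\ge 0$. Set $LB=-\infty$, $UB=+\infty$. In iteration $s=0,1,2,\dots$: if $\mathrm{NLP}(y^{(s)},\lambda)$ is feasible, let $x^{(s)}$ be an optimal solution and $f^{(s)}$ its optimal value, and if $f^{(s)}<UB$ set $UB:=f^{(s)}$ and store $(x^{(s)},y^{(s)})$ as incumbent; otherwise let $x^{(s)}$ be the $x$-part of an optimal solution of $\mathrm{NLP\text{-}Feas}(y^{(s)},\lambda)$. Set $\mathcal X^{(s+1)}:=\mathcal X^{(s)}\cup\{(x^{(s)},y^{(s)})\}$, solve $\mathrm{MILP}(\mathcal X^{(s+1)},\lambda)$, let $LB$ be its optimal value and let $y^{(s+1)}$ be the integer part of the optimal solution found. Stop when $UB-LB\le\varepsilon_{\mathrm{tol}}$, returning the incumbent and the set of linearization points. (With $\varepsilon_{\mathrm{tol}}=0$, termination means $UB=LB$.) Definitions. An optimal solution $(x^*,y^* )$ to $(P_\lambda)$ is parameter stable (a parameter stable optimum) if there exists $\delta>0$ such that for all $\bar\lambda\in B(\lambda,\delta)\cap P$ there is an $x\in\mathbb R^n$ such that $(x,y^* )$ is an optimal solution to $(P_{\bar\lambda})$. An optimal solution $(x^*,y^* )$ to $\mathrm{MILP}(\mathcal X,\lambda)$ is integer unique if there exists $\varepsilon>0$ such that $c^\top x+d^\top y>c^\top x^*+d^\top y^*+\varepsilon$ for every feasible point $(x,y)\in\Omega(\mathcal X,\lambda)$ with $y\ne y^*$. *)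

(* Defs.v *)
From HB Require Import structures.
From mathcomp Require Import all_boot all_order all_algebra.
From mathcomp Require Import all_classical all_reals all_analysis.

Set Implicit Arguments.
Unset Strict Implicit.
Unset Printing Implicit Defensive.

Import Order.TTheory GRing.Theory Num.Theory.
Import numFieldNormedType.Exports.

Local Open Scope classical_set_scope.
Local Open Scope ring_scope.

Definition vec_le (R : realType) (N : nat) (u v : 'cV[R]_N) : Prop :=
  forall i, u i 0 <= v i 0.

Definition dot (R : realType) (N : nat) (u v : 'cV[R]_N) : R :=
  (u^T *m v) 0 0.

(* The library norm on matrices is the sup norm, hence this definition. *)
Definition eucl_norm (R : realType) (N : nat) (u : 'cV[R]_N) : R :=
  Num.sqrt (dot u u).

Definition eucl_ball (R : realType) (N : nat) (u : 'cV[R]_N) (delta : R) :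
    set 'cV[R]_N :=
  [set v | eucl_norm (u - v) < delta].

Definition lower_ball (R : realType) (N : nat) (u : 'cV[R]_N) (delta : R) :
    set 'cV[R]_N :=
  [set v | eucl_ball u delta v /\ vec_le v u].

Definition grad (R : realType) (N : nat) (f : 'cV[R]_N -> R) (z : 'cV[R]_N) :
    'cV[R]_N :=
  \col_i 'D_(delta_mx i 0) f z.

Definition cont_diff (R : realType) (N : nat) (f : 'cV[R]_N -> R) : Prop :=
  (forall z, differentiable f z) /\ continuous (grad f).

Definition linearization (R : realType) (N : nat) (f : 'cV[R]_N -> R)
    (zbar z : 'cV[R]_N) : R :=
  f zbar + dot (grad f zbar) (z - zbar).

Definition minimizer (R : realType) (T : Type) (f : T -> R) (S : set T)
    (z : T) : Prop :=
  S z /\ forall w, S w -> f z <= f w.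

(* [gfun] is total in its parameter argument; only its values at parameters
   in [params] are constrained by the assumptions below. *)
Record pminlp (R : realType) (k n m p q r : nat) := PMINLP {
  params : set 'cV[R]_k;
  cobj : 'cV[R]_n;
  dobj : 'cV[R]_m;
  gfun : 'cV[R]_k -> 'cV[R]_(n + m) -> 'cV[R]_p;
  hfun : 'cV[R]_(n + m) -> 'cV[R]_q;
  Amx : 'M[R]_(r, n);
  Bmx : 'M[R]_(r, m);
  rhs : 'cV[R]_r
}.

Definition gcomp (R : realType) (k n m p q r : nat)
    (D : pminlp R k n m p q r) (lam : 'cV[R]_k) (i : 'I_p) :
    'cV[R]_(n + m) -> R :=
  fun z => gfun D lam z i 0.

Definition hcomp (R : realType) (k n m p q r : nat)
    (D : pminlp R k n m p q r) (i : 'I_q) : 'cV[R]_(n + m) -> R :=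
  fun z => hfun D z i 0.

Definition mixed (R : realType) (n m : nat) : Type :=
  ('cV[R]_n * 'cV[int]_m)%type.

Definition real_point (R : realType) (n m : nat) (z : mixed R n m) :
    'cV[R]_(n + m) :=
  col_mx z.1 (map_mx intr z.2).

Definition cost (R : realType) (k n m p q r : nat)
    (D : pminlp R k n m p q r) (z : mixed R n m) : R :=
  dot (cobj D) z.1 + dot (dobj D) (map_mx intr z.2).

Definition feas_L (R : realType) (k n m p q r : nat)
    (D : pminlp R k n m p q r) : set 'cV[R]_(n + m) :=
  [set z | vec_le (Amx D *m usubmx z + Bmx D *m dsubmx z) (rhs D)].

Definition feas (R : realType) (k n m p q r : nat)
    (D : pminlp R k n m p q r) (lam : 'cV[R]_k) : set (mixed R n m) :=
  [set z | [/\ vec_le (gfun D lam (real_point z)) 0,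
               vec_le (hfun D (real_point z)) 0
             & feas_L D (real_point z)]].

Definition optimal (R : realType) (k n m p q r : nat)
    (D : pminlp R k n m p q r) (lam : 'cV[R]_k) (z : mixed R n m) : Prop :=
  minimizer (cost D) (feas D lam) z.

Definition nlp_feas_set (R : realType) (k n m p q r : nat)
    (D : pminlp R k n m p q r) (y : 'cV[int]_m) (lam : 'cV[R]_k) :
    set 'cV[R]_n :=
  [set x | feas D lam (x, y)].

Definition nlp_optimal (R : realType) (k n m p q r : nat)
    (D : pminlp R k n m p q r) (y : 'cV[int]_m) (lam : 'cV[R]_k)
    (x : 'cV[R]_n) : Prop :=
  minimizer (fun x => cost D (x, y)) (nlp_feas_set D y lam) x.

Definition nlpfeas_set (R : realType) (k n m p q r : nat)
    (D : pminlp R k n m p q r) (y : 'cV[int]_m) (lam : 'cV[R]_k) :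
    set (R * 'cV[R]_n) :=
  [set tx | [/\ forall i, gcomp D lam i (real_point (tx.2, y)) <= tx.1,
                forall i, hcomp D i (real_point (tx.2, y)) <= tx.1
              & feas_L D (real_point (tx.2, y))]].

Definition nlpfeas_optimal (R : realType) (k n m p q r : nat)
    (D : pminlp R k n m p q r) (y : 'cV[int]_m) (lam : 'cV[R]_k)
    (tx : R * 'cV[R]_n) : Prop :=
  minimizer fst (nlpfeas_set D y lam) tx.

Definition Omega (R : realType) (k n m p q r : nat)
    (D : pminlp R k n m p q r) (X : set (mixed R n m)) (lam : 'cV[R]_k) :
    set (mixed R n m) :=
  [set z | feas_L D (real_point z) /\
    forall zbar, X zbar ->
      (forall j, linearization (gcomp D lam j)
                   (real_point zbar) (real_point z) <= 0) /\
      (forall j, linearization (hcomp D j)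
                   (real_point zbar) (real_point z) <= 0)].

Definition milp_optimal (R : realType) (k n m p q r : nat)
    (D : pminlp R k n m p q r) (X : set (mixed R n m)) (lam : 'cV[R]_k)
    (z : mixed R n m) : Prop :=
  minimizer (cost D) (Omega D X lam) z.

(* The constraint [nlp_constraint D y lam i x <= 0] is active at x when its
   left-hand side vanishes. *)
Definition nlp_constraint (R : realType) (k n m p q r : nat)
    (D : pminlp R k n m p q r) (y : 'cV[int]_m) (lam : 'cV[R]_k)
    (i : 'I_p + 'I_q + 'I_r) (x : 'cV[R]_n) : R :=
  match i with
  | inl (inl j) => gcomp D lam j (real_point (x, y))
  | inl (inr j) => hcomp D j (real_point (x, y))
  | inr j => (Amx D *m x + Bmx D *m map_mx intr y - rhs D) j 0
  end.

Definition licq (R : realType) (k n m p q r : nat)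
    (D : pminlp R k n m p q r) (y : 'cV[int]_m) (lam : 'cV[R]_k)
    (x : 'cV[R]_n) : Prop :=
  free [seq grad (nlp_constraint D y lam i) x
       | i <- enum {: 'I_p + 'I_q + 'I_r} & nlp_constraint D y lam i x == 0].

Definition standing_assumptions (R : realType) (k n m p q r : nat)
    (D : pminlp R k n m p q r) : Prop :=
  [/\ params D !=set0 /\ connected (params D),
      forall lam, params D lam ->
        (forall i, convex_function setT (gcomp D lam i) /\
                   cont_diff (gcomp D lam i)) /\
        (forall i, convex_function setT (hcomp D i) /\
                   cont_diff (hcomp D i)),
      feas_L D !=set0 /\ bounded_set (feas_L D),
      forall z, feas_L D z -> {within params D, continuous (gfun D ^~ z)}
    & forall lam y, params D lam -> nlp_feas_set D y lam !=set0 ->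
        forall x, nlp_optimal D y lam x -> licq D y lam x].

Record oa_state (R : realType) (n m : nat) := OAState {
  oa_LB : \bar R;
  oa_UB : \bar R;
  oa_incumbent : option (mixed R n m);
  oa_points : set (mixed R n m);
  oa_y : 'cV[int]_m
}.

Definition oa_init (R : realType) (n m : nat) (y0 : 'cV[int]_m)
    (X0 : set (mixed R n m)) : oa_state R n m :=
  OAState -oo%E +oo%E None X0 y0.

(* Effect of solving NLP(y, lam), or NLP-Feas(y, lam) when the former is
   infeasible, on the upper bound and on the incumbent; x is the point found. *)
Definition oa_nlp_step (R : realType) (k n m p q r : nat)
    (D : pminlp R k n m p q r) (lam : 'cV[R]_k) (s : oa_state R n m)
    (x : 'cV[R]_n) (UB' : \bar R) (inc' : option (mixed R n m)) : Prop :=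
  let y := oa_y s in
  [/\ nlp_feas_set D y lam !=set0,
      nlp_optimal D y lam x
    & (UB', inc') =
        if ((cost D (x, y))%:E < oa_UB s)%E
        then ((cost D (x, y))%:E, Some (x, y))
        else (oa_UB s, oa_incumbent s)]
  \/
  [/\ ~ (nlp_feas_set D y lam !=set0),
      exists t, nlpfeas_optimal D y lam (t, x)
    & (UB', inc') = (oa_UB s, oa_incumbent s)].

(* One iteration; it is a relation because the optimal solutions of the
   subproblems need not be unique and any of them may be returned. *)
Definition oa_iteration (R : realType) (k n m p q r : nat)
    (D : pminlp R k n m p q r) (lam : 'cV[R]_k) (s s' : oa_state R n m) :
    Prop :=
  exists x : 'cV[R]_n,
    [/\ oa_nlp_step D lam s x (oa_UB s') (oa_incumbent s'),
        oa_points s' = oa_points s `|` [set (x, oa_y s)]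
      & exists2 x' : 'cV[R]_n,
          milp_optimal D (oa_points s') lam (x', oa_y s') &
          oa_LB s' = (cost D (x', oa_y s'))%:E].

Definition oa_stop (R : realType) (n m : nat) (eps_tol : R)
    (s : oa_state R n m) : Prop :=
  (oa_UB s - oa_LB s <= eps_tol%:E)%E.

(* [oa_exec D lam eps_tol s N s']: from state s the algorithm performs exactly
   N iterations, the stopping test succeeding for the first time after the
   last of them, and ends in state s'. *)
Inductive oa_exec (R : realType) (k n m p q r : nat)
    (D : pminlp R k n m p q r) (lam : 'cV[R]_k) (eps_tol : R) :
    oa_state R n m -> nat -> oa_state R n m -> Prop :=
| oa_exec_stop s s' :
    oa_iteration D lam s s' -> oa_stop eps_tol s' ->
    oa_exec D lam eps_tol s 1 s'
| oa_exec_continue s s' N s'' :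
    oa_iteration D lam s s' -> ~ oa_stop eps_tol s' ->
    oa_exec D lam eps_tol s' N s'' ->
    oa_exec D lam eps_tol s N.+1 s''.

Definition parameter_stable (R : realType) (k n m p q r : nat)
    (D : pminlp R k n m p q r) (lam : 'cV[R]_k) (z : mixed R n m) : Prop :=
  optimal D lam z /\
  exists2 delta : R, 0 < delta &
    forall lam', (eucl_ball lam delta `&` params D) lam' ->
      exists x, optimal D lam' (x, z.2).

Definition integer_unique (R : realType) (k n m p q r : nat)
    (D : pminlp R k n m p q r) (X : set (mixed R n m)) (lam : 'cV[R]_k)
    (z : mixed R n m) : Prop :=
  milp_optimal D X lam z /\
  exists2 eps : R, 0 < eps &
    forall w, Omega D X lam w -> w.2 <> z.2 -> cost D z + eps < cost D w.

(* Main.v *)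
(** LICQ gives a direction along which all active constraints of an NLP
decrease to first order. At lam0 a small step along it makes all constraints of
NLP(ys, lam0) strict, so the point reached stays feasible for nearby parameters
and the optimal value rises by at most the gap eps of integer uniqueness.
Since F >= 0 and lam1 <= lam0, the relaxation Omega only shrinks from lam0 to
lam1, so points with integer part different from ys cannot beat that value.
For integer part ys, adding the linearizations at an optimal solution of
NLP(ys, lam1) suffices: a cheaper point of the relaxation would give a feasible
descent direction once perturbed by the LICQ direction, so no multipliers (KKT)
are needed. *)

Require Import Defs.
From HB Require Import structures.
From mathcomp Require Import all_boot all_order all_algebra.
From mathcomp Require Import all_classical all_reals all_analysis.
From mathcomp Require Import ring lra.

Set Implicit Arguments.
Unset Strict Implicit.
Unset Printing Implicit Defensive.

Import Order.TTheory GRing.Theory Num.Theory.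
Import numFieldNormedType.Exports.

Local Open Scope classical_set_scope.
Local Open Scope ring_scope.

(** Used to choose small steps and radii: every [t] below -a / (1 + |b|) works, the 1 covering the
    case [b = 0]. *)
Lemma near_right_affine_lt0 {R : realType} (a b : R) : a < 0 ->
  \forall t \near 0^'+, a + t * b < 0.
Proof.
move=> a0; near=> t.
have t0 : 0 < t by [].
have b1 : 0 < 1 + `|b| by rewrite ltr_wpDr.
have : t < - a / (1 + `|b|).
  by near: t; apply: nbhs_right_lt; rewrite divr_gt0 ?oppr_gt0.
rewrite ltr_pdivlMr//; have := ler_norm b; nra.
Unshelve. all: by end_near. Qed.

(** * Euclidean inner product, dual vectors and gradients *)

Section Dot.
Context {R : realType} {N : nat}.
Implicit Types u v w : 'cV[R]_N.

Lemma dotE u v : dot u v = \sum_i u i 0 * v i 0.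
Proof. by rewrite /dot mxE; apply: eq_bigr => i _; rewrite mxE. Qed.

Lemma dotDr u v w : dot u (v + w) = dot u v + dot u w.
Proof. by rewrite /dot mulmxDr mxE. Qed.

Lemma dotZr (a : R) u v : dot u (a *: v) = a * dot u v.
Proof. by rewrite /dot -scalemxAr mxE. Qed.

Lemma coord_le_eucl_norm u i : `|u i 0| <= eucl_norm u.
Proof.
rewrite -sqrtr_sqr /eucl_norm dotE ler_wsqrtr// (bigD1 i)//= -expr2 lerDl.
by apply: sumr_ge0 => j _; rewrite -expr2 sqr_ge0.
Qed.

(* e represents the form v |-> a * (sum of the coordinates of v along s). *)
Lemma free_dual (s : seq 'cV[R]_N) (a : R) : free s ->
  exists e, forall v, v \in s -> dot v e = a.
Proof.
move=> fs; pose phi v := \sum_j coord (in_tuple s) j v.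
exists (\col_i (a * phi (delta_mx i 0))) => v vs.
have phiE w : phi w = \sum_i w i 0 * phi (delta_mx i 0).
  rewrite /phi; under eq_bigr => j _.
    rewrite {1}[w]matrix_sum_delta linear_sum.
    under eq_bigr => i _ do rewrite bigop.big_ord1 linearZ /=.
    over.
  by rewrite exchange_big /=; apply: eq_bigr => i _; rewrite mulr_sumr.
rewrite dotE; under eq_bigr => i _ do rewrite mxE mulrCA.
rewrite -mulr_sumr -phiE /phi.
have [k ks <-] := nthP 0 vs; pose K := Ordinal ks.
(* Coordinates along a free family are dual to it: on its [K]-th vector only the [K]-th coordinate
   survives, and it equals 1. *)
rewrite (bigD1 K)//= (coord_free (X := in_tuple s) K K fs) eqxx.
rewrite big1 ?addr0 ?mulr1// => j jK.
by rewrite (coord_free (X := in_tuple s) K j fs) eq_sym (negbTE jK).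
Qed.

Lemma dot_grad (f : 'cV[R]_N -> R) z v :
  differentiable f z -> dot (grad f z) v = 'D_v f z.
Proof.
move=> df; rewrite dotE (deriveE v df) {2}[v]matrix_sum_delta linear_sum.
apply: eq_bigr => i _.
by rewrite bigop.big_ord1 linearZ /= mxE deriveE// mulrC.
Qed.

End Dot.

(** The constant cancels in every difference quotient, so the gradients agree even without
    differentiability. *)
Lemma linearization_addc {R : realType} {N : nat} (f f' : 'cV[R]_N -> R) a z w :
  (forall u, f u = f' u + a) -> linearization f z w = linearization f' z w + a.
Proof.
move=> ff'; rewrite /linearization ff' addrAC.
suff -> : grad f z = grad f' z by [].
apply/matrixP => i j; rewrite !mxE /derive.
by under eq_fun => h do rewrite /= !ff' opprD addrACA subrr addr0.
Qed.

(** * One-sided directional derivatives and the gradient inequality *)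

Section Right_derivative.
Context {R : realType} {V : normedModType R}.
Implicit Types (f : V -> R) (x v : V).

Lemma derivable_cvg_right f x v : derivable f x v ->
  t^-1 * (f (x + t *: v) - f x) @[t --> 0^'+] --> 'D_v f x.
Proof.
move=> df; apply: cvg_dnbhs_at_right.
by under eq_fun do rewrite [x + _]addrC; apply: df.
Qed.

Lemma derivable_continuous_right f x v : derivable f x v ->
  f (x + t *: v) @[t --> 0^'+] --> f x.
Proof.
(* Along the line this is a function of one real variable, where derivability implies continuity. *)
move=> /derivable1P/derivable1_diffP/differentiable_continuous c.
apply: cvg_at_right_filter.
have := c; rewrite /prop_for /continuous_at scale0r add0r.
by under eq_fun do rewrite [_ + x]addrC.
Qed.

(** A strictly negative value persists by continuity; from the value 0, the difference quotients are
    eventually negative. *)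
Lemma near_right_lt0 f x v :
  derivable f x v -> f x <= 0 -> (f x = 0 -> 'D_v f x < 0) ->
  \forall t \near 0^'+, f (x + t *: v) < 0.
Proof.
move=> df; rewrite le_eqVlt => /predU1P[fx|fx _]; last first.
  exact: cvgr_lt (derivable_continuous_right df) _ fx.
move=> /(_ fx) /(cvgr_lt _ (derivable_cvg_right df)) H; near=> t.
have : t^-1 * (f (x + t *: v) - f x) < 0 by near: t.
by rewrite fx subr0 pmulr_rlt0// invr_gt0.
Unshelve. all: by end_near. Qed.

(** By convexity the difference quotients at steps [t] in ]0, 1] are bounded by the slope of the
    chord, and the bound passes to the limit. *)
Lemma derive_le_convex f x y :
  convex_function setT f -> derivable f x (y - x) ->
  'D_(y - x) f x <= f y - f x.
Proof.
move=> cf /derivable_cvg_right Df.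
rewrite -(cvg_lim _ Df)//; apply: limr_le; first exact: (cvgP _ Df).
near=> t.
have t0 : 0 < t by [].
have t1 : t <= 1 by near: t; apply: nbhs_right_le.
rewrite ler_pdivrMl//.
have := cf (Itv01 (ltW t0) t1) y x (in_setT _) (in_setT _).
rewrite convRE /= /unstable.onem.
set w := (X in f X <= _).
have -> : (w : V) = x + t *: (y - x).
  rewrite /w /conv /= /unstable.onem scalerBl scale1r scalerBr.
  exact: addrCA.
lra.
Unshelve. all: by end_near. Qed.

End Right_derivative.

Lemma linearization_le {R : realType} {N : nat} (f : 'cV[R]_N -> R) z w :
  convex_function setT f ->
  differentiable f z -> linearization f z w <= f w.
Proof.
move=> cf df; rewrite /linearization dot_grad// -lerBrDl.
by apply: derive_le_convex => //; apply: diff_derivable.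
Qed.

(** * NLP constraints for a fixed integer part *)

Section Constraints.
Context {R : realType} {k n m p q r : nat} (D : pminlp R k n m p q r).
Implicit Types (x d : 'cV[R]_n) (y : 'cV[int]_m) (lam : 'cV[R]_k).

Lemma real_pointD x d y (t : R) :
  real_point (x + t *: d, y) = real_point (x, y) + t *: col_mx d 0.
Proof. by rewrite /real_point scale_col_mx add_col_mx scaler0 addr0. Qed.

(** With equal difference quotients, derivability and derivatives transfer without a chain rule. *)
Lemma quotient_real_point (f : 'cV[R]_(n + m) -> R) x d y :
  (fun h : R => h^-1 *: (((fun x => f (real_point (x, y))) \o shift x) (h *: d)
     - f (real_point (x, y)))) =
  (fun h : R => h^-1 *: ((f \o shift (real_point (x, y))) (h *: col_mx d 0)
     - f (real_point (x, y)))).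
Proof.
apply: funext => h /=.
by rewrite [_ + x]addrC real_pointD [_ + real_point _]addrC.
Qed.

Lemma derivable_real_point (f : 'cV[R]_(n + m) -> R) x d y :
  derivable f (real_point (x, y)) (col_mx d 0) ->
  derivable (fun x => f (real_point (x, y))) x d.
Proof. by rewrite /derivable quotient_real_point. Qed.

Lemma derive_real_point (f : 'cV[R]_(n + m) -> R) x d y :
  'D_d (fun x => f (real_point (x, y))) x =
  'D_(col_mx d 0) f (real_point (x, y)).
Proof. by rewrite /derive quotient_real_point. Qed.

Lemma dot_grad_real_point (f : 'cV[R]_(n + m) -> R) x d y :
  dot (grad (fun x => f (real_point (x, y))) x) d =
  dot (grad f (real_point (x, y))) (col_mx d 0).
Proof.
rewrite !dotE big_split_ord /= [X in _ = _ + X]big1 ?addr0; last first.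
  by move=> i _; rewrite col_mxEd [X in _ * X]mxE mulr0.
apply: eq_bigr => i _; rewrite col_mxEu !mxE derive_real_point.
congr ('D__ f _ * _).
(* Padding a unit vector of the [x]-space with zeros gives a unit vector of the full space. *)
apply/matrixP => a b; rewrite !mxE.
case: splitP => c ac; rewrite !mxE -!val_eqE /= ac //.
by rewrite gtn_eqF// ltn_addr.
Qed.

Lemma linearization_real_point (f : 'cV[R]_(n + m) -> R) x x' y :
  linearization f (real_point (x, y)) (real_point (x', y)) =
  f (real_point (x, y)) +
  dot (grad (fun x => f (real_point (x, y))) x) (x' - x).
Proof.
rewrite /linearization dot_grad_real_point; congr (_ + dot _ _).
by rewrite /real_point /= opp_col_mx add_col_mx subrr.
Qed.

Lemma is_derive_affine (A : 'M[R]_(r, n)) (c : 'cV[R]_r) j x d :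
  is_derive x d (fun x => (A *m x + c) j 0) ((A *m d) j 0).
Proof.
have H : h^-1 *: (((fun x => (A *m x + c) j 0) \o shift x) (h *: d)
    - (A *m x + c) j 0) @[h --> (0 : R)^'] --> (A *m d) j 0.
  (* The difference quotient of an affine map is constant for [h != 0]. *)
  apply: cvg_near_cst; near=> h.
  have h0 : h != 0 by near: h; apply: nbhs_dnbhs_neq.
  rewrite /= mulmxDr -scalemxAr !mxE /GRing.scale /=.
  by field.
by apply: DeriveDef; [apply: (cvgP _ H) | apply: cvg_lim].
Unshelve. all: by end_near. Qed.

Lemma dot_grad_affine (A : 'M[R]_(r, n)) (c : 'cV[R]_r) j x d :
  dot (grad (fun x => (A *m x + c) j 0) x) d = (A *m d) j 0.
Proof.
rewrite dotE mxE; apply: eq_bigr => i _; congr (_ * _).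
by rewrite mxE (derive_val (is_derive := is_derive_affine _ _ _ _ _)) -colE mxE.
Qed.

Hypothesis hD : standing_assumptions D.

Let gcomp_convex lam i : params D lam -> convex_function setT (gcomp D lam i).
Proof. by case: hD => _ h _ _ _ /h[/(_ i)[]]. Qed.

Let gcomp_diff lam i z : params D lam -> differentiable (gcomp D lam i) z.
Proof. by case: hD => _ h _ _ _ /h[/(_ i)[_ []]]. Qed.

Let hcomp_convex lam i : params D lam -> convex_function setT (hcomp D i).
Proof. by case: hD => _ h _ _ _ /h[_ /(_ i)[]]. Qed.

Let hcomp_diff lam i z : params D lam -> differentiable (hcomp D i) z.
Proof. by case: hD => _ h _ _ _ /h[_ /(_ i)[_ []]]. Qed.

Lemma nlp_constraint_linearE y lam j :
  nlp_constraint D y lam (inr j) =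
  fun x => (Amx D *m x + (Bmx D *m map_mx intr y - rhs D)) j 0.
Proof. by apply: funext => x; rewrite /= addrA. Qed.

Lemma is_derive_nlp_constraint y lam i x d : params D lam ->
  is_derive x d (nlp_constraint D y lam i)
    (dot (grad (nlp_constraint D y lam i) x) d).
Proof.
move=> Plam; case: i => [[j|j]|j].
- rewrite dot_grad_real_point dot_grad; last exact: gcomp_diff.
  rewrite -derive_real_point; apply: derivableP; apply: derivable_real_point.
  exact/diff_derivable/gcomp_diff.
- rewrite dot_grad_real_point dot_grad; last exact: hcomp_diff Plam.
  rewrite -derive_real_point; apply: derivableP; apply: derivable_real_point.
  exact/diff_derivable/(hcomp_diff _ _ Plam).
- by rewrite nlp_constraint_linearE dot_grad_affine; apply: is_derive_affine.
Qed.

Lemma nlp_feas_setP y lam x : nlp_feas_set D y lam x <->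
  forall i, nlp_constraint D y lam i x <= 0.
Proof.
have feas_LE j : nlp_constraint D y lam (inr j) x <= 0 <->
    (Amx D *m x + Bmx D *m map_mx intr y) j 0 <= rhs D j 0.
  by rewrite /= [X in X <= 0]mxE [X in _ + X <= 0]mxE subr_le0.
split=> [[gx hx Ax] [[j|j]|j]|H].
- by have := gx j; rewrite mxE.
- by have := hx j; rewrite mxE.
- by apply/feas_LE; have := Ax j; rewrite /= col_mxKu col_mxKd.
- split=> j.
  + by have := H (inl (inl j)); rewrite mxE.
  + by have := H (inl (inr j)); rewrite mxE.
  + by have /feas_LE := H (inr j); rewrite /= col_mxKu col_mxKd.
Qed.

(** Linear independence lets the slopes of all active constraints be prescribed at once; -1 makes
    each of them decrease. *)
Lemma licq_direction y lam x : licq D y lam x ->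
  exists e, forall i, nlp_constraint D y lam i x = 0 ->
    dot (grad (nlp_constraint D y lam i) x) e = -1.
Proof.
move=> /(free_dual (-1))[e he]; exists e => i ci.
apply: he; apply: (map_f (fun i => grad (nlp_constraint D y lam i) x)).
by rewrite mem_filter ci eqxx mem_enum.
Qed.

(** Each constraint admits its own range of small steps; there are finitely many, so a common range
    exists. *)
Lemma near_strictly_feasible y lam x d : params D lam ->
  nlp_feas_set D y lam x ->
  (forall i, nlp_constraint D y lam i x = 0 ->
     dot (grad (nlp_constraint D y lam i) x) d < 0) ->
  \forall t \near 0^'+, forall i, nlp_constraint D y lam i (x + t *: d) < 0.
Proof.
move=> Plam /nlp_feas_setP fx hd; apply: filter_forall => i.
have Dc := is_derive_nlp_constraint y i x d Plam.
apply: near_right_lt0 => //.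
by rewrite (derive_val (is_derive := Dc)); apply: hd.
Qed.

Lemma costD x d y t :
  cost D (x + t *: d, y) = cost D (x, y) + t * dot (cobj D) d.
Proof. by rewrite /cost /= dotDr dotZr addrAC. Qed.

Lemma linearized_optimality y lam x x' : params D lam ->
  nlp_optimal D y lam x -> licq D y lam x ->
  Omega D [set (x, y)] lam (x', y) -> cost D (x, y) <= cost D (x', y).
Proof.
move=> Plam [fx optx] /licq_direction[e he] [Lx' /(_ _ erefl)[gx' hx']].
rewrite leNgt; apply/negP => lt_cost.
(* The linearized constraints make x' - x a weakly feasible descent direction;
   adding a small multiple of e turns it into a strictly feasible one. *)
pose d := x' - x.
have act i : nlp_constraint D y lam i x = 0 ->
    dot (grad (nlp_constraint D y lam i) x) d <= 0.
  case: i => [[j|j]|j] ci.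
  - by have := gx' j; rewrite linearization_real_point [X in X + _]ci add0r.
  - by have := hx' j; rewrite linearization_real_point [X in X + _]ci add0r.
  - rewrite nlp_constraint_linearE dot_grad_affine /d mulmxBr.
    have := Lx' j; move: ci; rewrite /= col_mxKu col_mxKd !mxE; lra.
have {}lt_cost : dot (cobj D) d < 0.
  have x'E : x' = x + 1 *: d by rewrite scale1r /d addrC subrK.
  by move: lt_cost; rewrite x'E costD mul1r gtrDl.
near (0 : R)^'+ => s; pose v := d + s *: e.
have s0 : 0 < s by [].
(* For small [s] the strict decrease of the cost along [d] survives the perturbation, while each
   active slope drops by [s]. *)
have cv : dot (cobj D) v < 0.
  by rewrite dotDr dotZr; near: s; apply: near_right_affine_lt0.
have hv i : nlp_constraint D y lam i x = 0 ->
    dot (grad (nlp_constraint D y lam i) x) v < 0.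
  by move=> ci; rewrite dotDr dotZr he//; have := act i ci; lra.
near (0 : R)^'+ => t.
have t0 : 0 < t by [].
have /optx : nlp_feas_set D y lam (x + t *: v).
  apply/nlp_feas_setP => i; apply/ltW; move: i.
  by near: t; apply: near_strictly_feasible.
by rewrite costD lerDl pmulr_rge0// leNgt cv.
Unshelve. all: by end_near. Qed.

(** Linearizations of convex functions are underestimators, so they cut off no feasible point. *)
Lemma feas_Omega X lam : params D lam -> feas D lam `<=` Omega D X lam.
Proof.
move=> Plam z [gz hz Lz]; split=> // w _; split=> j.
- have := gz j; rewrite mxE; apply: le_trans.
  by apply: linearization_le; [apply: gcomp_convex | apply: gcomp_diff].
- have := hz j; rewrite mxE; apply: le_trans.
  apply: linearization_le; first exact: hcomp_convex Plam.
  exact: hcomp_diff Plam.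
Qed.

(** * Perturbation of the right-hand side by the parameter *)

Section Right_hand_side_parameter.
Variables (g : 'cV[R]_(n + m) -> 'cV[R]_p) (F : 'M[R]_(p, k)).
Hypothesis hg : forall lam, params D lam ->
  forall z, gfun D lam z = g z - F *m lam.

Let gcompE lam lam' i z : params D lam -> params D lam' ->
  gcomp D lam' i z = gcomp D lam i z + (F *m (lam - lam')) i 0.
Proof. by move=> P P'; rewrite /gcomp !hg// mulmxBr !mxE; ring. Qed.

(** Passing from [lam] to [lam'] raises each linearization of [g] by the nonnegative constant
    [F *m (lam - lam')], which tightens the cuts. *)
Lemma Omega_monotone X lam lam' : (forall i j, 0 <= F i j) ->
  params D lam -> params D lam' -> vec_le lam' lam ->
  Omega D X lam' `<=` Omega D X lam.
Proof.
move=> F0 P P' le_lam z [Lz Xz]; split=> // w /Xz[gz hz]; split=> // j.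
have := gz j; apply: le_trans.
rewrite (linearization_addc _ _ (fun z => gcompE j z P P')) lerDl mxE.
by apply: sumr_ge0 => i _; rewrite mulr_ge0// !mxE subr_ge0.
Qed.

Lemma gcomp_lt0_ball lam z : params D lam -> (forall i, gcomp D lam i z < 0) ->
  \forall delta \near 0^'+,
    forall lam', (eucl_ball lam delta `&` params D) lam' ->
    forall i, gcomp D lam' i z < 0.
Proof.
move=> P gz; near=> delta => lam' [lam'_ball P'].
(* Within distance [delta], component [i] rises by at most [delta] times the absolute row sum of
   [F]. *)
have H i : gcomp D lam i z + delta * \sum_j `|F i j| < 0.
  move: i; near: delta; apply: filter_forall => i.
  exact: near_right_affine_lt0.
move=> i; apply: le_lt_trans (H i); rewrite (gcompE _ _ P P') lerD2l.
rewrite mxE mulr_sumr; apply: ler_sum => j _.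
rewrite (le_trans (ler_norm _))// normrM mulrC ler_wpM2r//.
exact: le_trans (coord_le_eucl_norm _ _) (ltW lam'_ball).
Unshelve. all: by end_near. Qed.

Lemma near_value_le y lam x (eps : R) : params D lam ->
  nlp_feas_set D y lam x -> licq D y lam x -> 0 < eps ->
  \forall delta \near 0^'+,
    forall lam', (eucl_ball lam delta `&` params D) lam' ->
    exists2 x', nlp_feas_set D y lam' x' &
      cost D (x', y) <= cost D (x, y) + eps.
Proof.
move=> P fx /licq_direction[e he] eps0.
near (0 : R)^'+ => t.
have sx : forall i, nlp_constraint D y lam i (x + t *: e) < 0.
  by near: t; apply: near_strictly_feasible => // i /he ->; rewrite ltrN10.
have tc : - eps + t * dot (cobj D) e < 0.
  by near: t; apply: near_right_affine_lt0; rewrite oppr_lt0.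
(* One witness serves all nearby parameters: only the [g] constraints vary with them, and these hold
   strictly at it. *)
near=> delta => lam' B; exists (x + t *: e); last by rewrite costD; lra.
have gx' : forall i, gcomp D lam' i (real_point (x + t *: e, y)) < 0.
  move: lam' B; near: delta; apply: gcomp_lt0_ball => // i.
  exact: (sx (inl (inl i))).
apply/nlp_feas_setP => -[[j|j]|j]; apply: ltW; first exact: gx'.
- exact: (sx (inl (inr j))).
- exact: (sx (inr j)).
Unshelve. all: by end_near. Qed.

End Right_hand_side_parameter.

End Constraints.

Theorem theorem13 (R : realType) (k n m p q r : nat)
    (D : pminlp R k n m p q r)
    (hD : standing_assumptions D)
    (lam0 : 'cV[R]_k) (hlam0 : params D lam0)
    (xs : 'cV[R]_n) (ys : 'cV[int]_m)
    (hstable : parameter_stable D lam0 (xs, ys))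
    (X : set (mixed R n m)) (hX : finite_set X)
    (y0 : 'cV[int]_m) (X0 : set (mixed R n m)) (hX0 : finite_set X0)
    (eps0 : R) (heps0 : 0 <= eps0) (N : nat) (s0 : oa_state R n m)
    (hrun : oa_exec D lam0 eps0 (oa_init y0 X0) N s0)
    (hpoints : oa_points s0 `<=` X)
    (hunique : integer_unique D X lam0 (xs, ys))
    (g : 'cV[R]_(n + m) -> 'cV[R]_p) (F : 'M[R]_(p, k))
    (hF : forall i j, 0 <= F i j)
    (hg : forall lam, params D lam ->
      forall z, gfun D lam z = g z - F *m lam) :
  exists2 delta : R, 0 < delta &
    forall lam1, (lower_ball lam0 delta `&` params D) lam1 ->
    forall eps_tol : R, 0 <= eps_tol ->
      (exists s1, oa_exec D lam1 eps_tol (oa_init ys X) 1 s1) /\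
      (forall s1, oa_iteration D lam1 (oa_init ys X) s1 ->
        oa_stop eps_tol s1 /\
        exists2 z, oa_incumbent s1 = Some z & optimal D lam1 z).
Proof.

have [_ _ _ _ hlicq] := hD.
have [opt0 [delta0 delta0_gt0 stable]] := hstable.
have [_ [eps eps_gt0 unique]] := hunique.
have nlp_opt lam x : optimal D lam (x, ys) -> nlp_optimal D ys lam x.
  by case=> fx ox; split=> // w; apply: ox.
have [nf0 no0] := nlp_opt _ _ opt0.
have licq0 : licq D ys lam0 xs by apply: hlicq => //; exists xs.
near (0 : R)^'+ => delta.
have delta_gt0 : 0 < delta by [].
have delta_le : delta <= delta0 by near: delta; apply: nbhs_right_le.
have near_val : forall lam', (eucl_ball lam0 delta `&` params D) lam' ->
    exists2 x', nlp_feas_set D ys lam' x' &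
      cost D (x', ys) <= cost D (xs, ys) + eps.
  by near: delta; apply: (near_value_le hD hg).
exists delta => // lam1 [[ball1 le1] P1] eps_tol eps_tol_ge0.
have [x1 opt1] : exists x, optimal D lam1 (x, ys).
  by apply: stable; split=> //; apply: lt_le_trans delta_le.
have nopt1 := nlp_opt _ _ opt1.
have ne1 : nlp_feas_set D ys lam1 !=set0 by exists x1; case: nopt1.
(* This bounds the MILP value from below by the NLP value, whichever NLP solution is returned. *)
have LB_ge x w : nlp_optimal D ys lam1 x ->
    Omega D (X `|` [set (x, ys)]) lam1 w -> cost D (x, ys) <= cost D w.
  case: w => x' y nox [Lw Xw]; have [yE|yN] := pselect (y = ys).
    subst y; apply: (linearized_optimality hD P1 nox).
      by apply: hlicq.
    by split=> // z zE; apply: Xw; right.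
  (* At [lam0] such a point costs more than [cost D (xs, ys) + eps], which dominates the NLP value
     at [lam1] by [near_val]. *)
  have /(Omega_monotone hg hF hlam0 P1 le1)/unique/(_ yN)/ltW :
    Omega D X lam1 (x', y) by split=> // z zX; apply: Xw; left.
  apply: le_trans; have [x'' fx'' cx''] := near_val lam1 (conj ball1 P1).
  exact: le_trans (nox.2 _ fx'') cx''.
have stopping s1 : oa_iteration D lam1 (oa_init ys X) s1 ->
    oa_stop eps_tol s1 /\
    exists2 z, oa_incumbent s1 = Some z & optimal D lam1 z.
  case: s1 => LB UB inc pts y [x [/= step -> [x' opt' ->]]].
  (* [ne1] excludes the infeasible branch, and the initial bound [+oo] forces the incumbent to be
     updated. *)
  case: step => [[_ nox]|[//]]; rewrite /= ltry => -[-> ->]; split.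
    rewrite /oa_stop /= -EFinB lee_fin (le_trans _ eps_tol_ge0)// subr_le0.
    by apply: LB_ge => //; case: opt'.
  exists (x, ys) => //; split; first by case: nox.
  move=> w fw; apply: le_trans (nox.2 _ opt1.1) _; exact: opt1.2.
split=> //; pose c1 := ((cost D (x1, ys))%:E : \bar R).
(* A run exists: [x1] can be returned by both the NLP and the MILP, so the bounds coincide. *)
pose s1 := OAState c1 c1 (Some (x1, ys)) (X `|` [set (x1, ys)]) ys.
have it1 : oa_iteration D lam1 (oa_init ys X) s1.
  exists x1; split=> //=.
    by left; split=> //=; rewrite ltry.
  exists x1 => //; split; last by move=> w; apply: LB_ge.
  by apply: (feas_Omega hD) => //; case: opt1.
by exists s1; apply: oa_exec_stop => //; case: (stopping _ it1).
Unshelve. all: by end_near. Qed.
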